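(* Let $G$ be a finite undirected bipartite graph (possibly with multiple edges) with nonempty vertex set $V$ and edge set $E$, and let $b\in\mathbb{R}^V$ have all entries nonnegative. Let $u$ and $w$ be distinct vertices of the polytope $\mathcal{P}(G,b)$. Then $u$ and $w$ are the vertices of an edge of $\mathcal{P}(G,b)$ if and only if $\mathrm{gr}(u)\cup\mathrm{gr}(w)$ contains exactly one cycle.
   Context: $\delta_G(v)$ denotes the set of edges of $G$ incident with $v$. $\mathcal{P}(G,b)=\{x\in\mathbb{R}^E \mid x_e\ge 0 \text{ for each } e\in E,\ \sum_{e\in\delta_G(v)}x_e=b_v \text{ for each } v\in V\}$. An edge of a polytope is a one-dimensional face. For $x\in\mathcal{P}(G,b)$, the graph $\mathrm{gr}(x)$ of $x$ is the spanning subgraph of $G$ (vertex set $V$) with edge set $\{e\in E\mid x_e>0\}$. The union of spanning subgraphs of $G$ is the spanning subgraph whose edge set is the union of their edge sets. Two distinct vertices together with two distinct edges connecting them form a cycle of length 2. *)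

(* Defs.v *)
From HB Require Import structures.
From mathcomp Require Import all_boot all_order all_algebra.
From mathcomp Require Import classical_sets reals.

Set Implicit Arguments.
Unset Strict Implicit.
Unset Printing Implicit Defensive.

Import Order.TTheory GRing.Theory Num.Theory.
Local Open Scope ring_scope.

(* Finite undirected multigraph: an edge is sent to its set of endpoints, a
   singleton for a loop. Different edges may have the same endpoints. *)
Record multigraph (V E : finType) := Multigraph {
  ends : E -> {set V};
  card_ends : forall e, (0 < #|ends e| <= 2)%N
}.

Section Graphs.
Variables (V E : finType) (G : multigraph V E).

Definition incident (v : V) : {set E} := [set e | v \in ends G e].

Definition bipartite : Prop :=
  exists A : {set V}, forall e : E, exists x y : V,
    [/\ x \in A, y \notin A & ends G e = [set x; y]].

End Graphs.

(* A subgraph is given by its vertex set and its edge set. *)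
Definition subgraph (V E : finType) : Type := ({set V} * {set E})%type.

Definition union_subgraph (V E : finType) (H K : subgraph V E) :
  subgraph V E := (H.1 :|: K.1, H.2 :|: K.2).

Definition contained (V E : finType) (H K : subgraph V E) : Prop :=
  H.1 \subset K.1 /\ H.2 \subset K.2.

(* The cycle of length n.+1 with vertices v_0, ..., v_n and edges
   e_0, ..., e_n, where e_i joins v_i to v_(i+1) and e_n joins v_n to v_0
   ([ordS] is the cyclic successor). Cycles are identified when they are equal
   as subgraphs, so the starting point and the orientation do not matter. *)
Definition is_cycle (V E : finType) (G : multigraph V E)
    (C : subgraph V E) : Prop :=
  exists (n : nat) (v : 'I_n.+1 -> V) (e : 'I_n.+1 -> E),
    [/\ injective v, injective e,
        forall i, ends G (e i) = [set v i; v (ordS i)],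
        C.1 = [set v i | i : 'I_n.+1]
      & C.2 = [set e i | i : 'I_n.+1]].

Section Polytopes.
Variables (R : realType) (E : finType).

(* The codomain is R^o because {ffun E -> R^o} carries the structure of a
   finite-dimensional R-vector space. *)
Local Notation X := {ffun E -> R^o}.
Local Open Scope classical_set_scope.

Definition dotp (c x : X) : R := \sum_(e : E) (c e : R) * (x e : R).

Definition is_face (P F : set X) : Prop :=
  exists (c : X) (d : R),
    (forall x, P x -> dotp c x <= d) /\ F = P `&` [set x | dotp c x = d].

Definition is_vertex (P : set X) (x : X) : Prop := is_face P [set x].

Definition affine_hull (A : set X) : set X :=
  [set x | exists (n : nat) (p : 'I_n -> X) (a : 'I_n -> R),
     [/\ forall i, A (p i), \sum_(i < n) a i = 1
       & x = \sum_(i < n) a i *: p i]].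

(* Holds for no k when A is empty. *)
Definition has_dim (A : set X) (k : nat) : Prop :=
  exists (x0 : X) (U : {vspace X}),
    \dim U = k /\ affine_hull A = [set x | x - x0 \in U].

Definition is_edge (P F : set X) : Prop := is_face P F /\ has_dim F 1.

Definition vertices_of_an_edge (P : set X) (u w : X) : Prop :=
  exists F : set X, is_edge P F /\ [set x | is_vertex F x] = [set u; w].

End Polytopes.

Definition bmatching_polytope (R : realType) (V E : finType)
    (G : multigraph V E) (b : V -> R) : set {ffun E -> R^o} :=
  [set x : {ffun E -> R^o} |
     (forall e : E, 0 <= (x e : R)) /\
     (forall v : V, \sum_(e in incident G v) (x e : R) = b v)]%classic.

Definition gr (R : realType) (V E : finType) (x : {ffun E -> R^o}) :
  subgraph V E := ([set: V], [set e | 0 < (x e : R)]).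

(* Main.v *)
(** Let S be the union of the supports of u and w, and let K be the space of
    vectors supported in S whose values sum to zero around every vertex of G.
    Moving the midpoint of u and w along K in both directions stays in the
    polytope, hence in every face that contains u and w; conversely, the points
    of the polytope supported in S form a face inside u + K. So u and w span an
    edge iff K is the line through w - u. In a bipartite graph the alternating
    +1/-1 vector of a cycle in S belongs to K, and the support of a nonzero
    vector of K has no vertex of degree one, hence contains a cycle. If K is a
    line, all cycles in S thus have the support of w - u as edge set; if the
    cycle is unique, a vector of K vanishing on one of its edges is zero, so K
    is a line. *)
Require Import Defs.
From mathcomp Require Import all_boot all_order all_algebra.
From mathcomp Require Import classical_sets reals.
From mathcomp Require Import fintype finset zify ring lra.

Set Implicit Arguments.
Unset Strict Implicit.
Unset Printing Implicit Defensive.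

Import Order.TTheory GRing.Theory Num.Theory.
Local Open Scope ring_scope.

(** * Finding a cycle by walking in a multigraph *)

Section Walk.
Variables (V E : finType) (G : multigraph V E).

Lemma other_end (v : V) (e : E) :
  v \in ends G e -> exists v', ends G e = [set v; v'].
Proof.
move=> ve; have := card_ends G e; rewrite (cardsD1 v) ve.
case: (set_0Vmem (ends G e :\ v)) => [D0 _|[v' v'D] D2].
  by exists v; rewrite setUid -(setD1K ve) D0 setU0.
exists v'; rewrite -(setD1K ve); congr (_ |: _).
apply/eqP; rewrite eq_sym eqEcard sub1set v'D cards1 /=.
by move: D2; rewrite add1n ltnS; case/andP.
Qed.

(* Close a walk in [D] that never backtracks at its first repeated vertex. *)
Lemma cycle_of_degree_ge2 (D : {set E}) :
  D != set0 ->
  (forall v e, e \in D -> v \in ends G e ->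
     exists e', [/\ e' \in D, e' != e & v \in ends G e']) ->
  exists C, is_cycle G C /\ C.2 \subset D.
Proof.
case/set0Pn=> e0 e0D degD.
(* A state is a vertex paired with the edge of [D] by which the walk leaves it. *)
pose ok (s : V * E) := (s.2 \in D) && (s.1 \in ends G s.2).
pose step (s t : V * E) :=
  [&& ok t, t.2 != s.2 & ends G s.2 == [set s.1; t.1]].
have stepP s : ok s -> exists t, step s t.
  case: s => v e /andP[/= eD ve]; have [v' ev'] := other_end ve.
  have v'e : v' \in ends G e by rewrite ev' set22.
  have [e' [e'D e'e v'e']] := degD v' e eD v'e.
  by exists (v', e'); rewrite /step /ok /= e'D v'e' e'e ev' eqxx.
have [v0 v0e] : exists v0, v0 \in ends G e0.
  by apply/set0Pn; rewrite -card_gt0; case/andP: (card_ends G e0).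
(* The default [s] is never taken along the walk: by [stepP] every [ok] state has a successor, and
   the successor is [ok]. *)
pose f s := odflt s [pick t | step s t].
pose s k := iter k f (v0, e0).
have fP t : ok t -> step t (f t).
  move=> /stepP[t' tt']; rewrite /f; case: pickP => //= /(_ t').
  by rewrite tt'.
have okS k : ok (s k).
  elim: k => [|k /fP/and3P[]] //.
  by rewrite /ok /= e0D.
pose v k := (s k).1; pose e k := (s k).2.
have eD k : e k \in D by case/andP: (okS k).
have e_next k : e k.+1 != e k by case/and3P: (fP (s k) (okS k)).
have ends_e k : ends G (e k) = [set v k; v k.+1].
  by apply/eqP; case/and3P: (fP (s k) (okS k)).
have exj : exists j, [exists i : 'I_j, v i == v j].
  pose g (i : 'I_(#|V|.+1)) := v i.
  have /injectivePn[x [y xy gxy]] : ~~ injectiveb g.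
    apply/negP => /injectiveP/leq_card; rewrite card_ord; lia.
  wlog lt_xy : x y xy gxy / (x < y)%N.
    move=> W; case: (ltngtP x y) => [||/val_inj] xy'; first exact: (W x y).
      by apply: (W y x) => //; rewrite eq_sym.
    by rewrite xy' eqxx in xy.
  by exists y; apply/existsP; exists (Ordinal lt_xy); apply/eqP.
case: (ex_minnP exj) => j /existsP[i /eqP vij] jmin.
have vinj k l : (k < j)%N -> (l < j)%N -> v k = v l -> k = l.
  wlog lt_kl : k l / (k < l)%N.
    move=> W kj lj vkl; case: (ltngtP k l) => // kl; first exact: W.
    by apply/esym/W.
  move=> kj lj vkl; have : (j <= l)%N; last lia.
  by apply: jmin; apply/existsP; exists (Ordinal lt_kl); apply/eqP.
have einj k l : (k < j)%N -> (l < j)%N -> e k = e l -> k = l.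
  wlog lt_kl : k l / (k < l)%N.
    move=> W kj lj vkl; case: (ltngtP k l) => // kl; first exact: W.
    by apply/esym/W.
  (* A repeated edge forces [v l] to be [v k] or [v k.+1]. Injectivity below [j] leaves only
     [l = k.+1], which would be a backtrack. *)
  move=> kj lj ekl; have : v l \in ends G (e k) by rewrite ekl ends_e set21.
  rewrite ends_e => /set2P[/vinj|/vinj lk]; first by lia.
  have {}lk : l = k.+1 by apply: lk; lia.
  by have := e_next k; rewrite ekl lk eqxx.
have lt_ij := ltn_ord i; pose n := (j - i).-1.
have ub (k : 'I_n.+1) : (i + k < j)%N by have := ltn_ord k; lia.
pose v' (k : 'I_n.+1) := v (i + k)%N.
pose e' (k : 'I_n.+1) := e (i + k)%N.
exists ([set v' k | k : 'I_n.+1], [set e' k | k : 'I_n.+1]); split; last first.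
  by apply/subsetP => _ /imsetP[k _ ->]; apply: eD.
exists n, v', e'; split=> //.
- by move=> k l /vinj kl; apply: val_inj; have /= := kl (ub k) (ub l); lia.
- by move=> k l /einj kl; apply: val_inj; have /= := kl (ub k) (ub l); lia.
- move=> k; rewrite /e' ends_e; congr [set _; _]; rewrite /v' /=.
  have [kn|nk] := ltnP k n; first by rewrite modn_small ?addnS.
  have -> : k = n :> nat by have := ltn_ord k; lia.
  by rewrite modnn addn0 vij; congr v; lia.
Qed.

End Walk.

(** * Vectors with zero sum around every vertex, and their cycles *)

Section Balanced.
Variables (R : realType) (V E : finType) (G : multigraph V E).
Local Notation X := {ffun E -> R^o}.

Definition balanced (y : X) : Prop :=
  forall v, \sum_(e in incident G v) (y e : R) = 0.

Lemma balanced_lin (a c : R) (y z : X) :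
  balanced y -> balanced z -> balanced (a *: y + c *: z).
Proof.
move=> by0 bz0 v; rewrite (eq_bigr (fun e => a * (y e : R) + c * (z e : R))).
  by rewrite big_split /= -!mulr_sumr by0 bz0 !mulr0 addr0.
by move=> e _; rewrite !ffunE.
Qed.

(** A zero sum cannot have exactly one nonzero term, so at each of its ends an edge of the support
    meets another one. *)
Lemma balanced_cycle (y : X) :
  balanced y -> y != 0 ->
  exists C, is_cycle G C /\ C.2 \subset [set e | y e != 0].
Proof.
move=> bal y0; apply: cycle_of_degree_ge2.
  apply: contra_neq y0 => D0; apply/ffunP => e; rewrite ffunE; apply/eqP.
  by have := in_set0 e; rewrite -D0 inE => /negbFE.
move=> v e; rewrite inE => ye ve.
have [e' /and3P[]|noe] :=
  pickP [pred e' | [&& y e' != 0, e' != e & v \in ends G e']].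
  by exists e'; split; rewrite ?inE.
have := bal v; rewrite (bigD1 e) ?inE //= big1 ?addr0 => [/eqP|e' /andP[]].
  by rewrite (negPf ye).
rewrite inE => ve' e'e; apply/eqP; have /= := noe e'.
by rewrite ve' e'e !andbT => /negbFE.
Qed.

Lemma cycle_balanced (C : subgraph V E) :
  bipartite G -> is_cycle G C ->
  exists y : X, balanced y /\ [set e | y e != 0] = C.2.
Proof.
case=> A bipA [n [v [e [vinj einj ends_e _ ->]]]].
have vA i : (v (ordS i) \in A) = (v i \notin A).
  have [x [z [xA zA]]] := bipA (e i); rewrite ends_e => vxz.
  have /set2P xv : x \in [set v i; v (ordS i)] by rewrite vxz set21.
  have /set2P zv : z \in [set v i; v (ordS i)] by rewrite vxz set22.
  move: xA zA; case: xv => ->; case: zv => ->;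
    by case: (v i \in A); case: (v (ordS i) \in A).
have vS i : v i != v (ordS i).
  by apply/negP => /eqP vi; have := vA i; rewrite -vi; case: (_ \in A).
(* Reading the sign off the side of [v i] makes it alternate along the cycle, also at the closing
   edge, with no parity argument on the length. *)
pose sg i : R := (-1) ^+ (v i \in A).
exists [ffun x => \sum_i (if e i == x then sg i else 0)]; split; last first.
  apply/setP => x; rewrite inE ffunE; apply/idP/imsetP => [|[i _ ->]].
    have [i /eqP <-|noi] := pickP [pred i | e i == x]; first by exists i.
    by rewrite big1 ?eqxx // => i _; have /= -> := noi i.
  rewrite (bigD1 i) //= eqxx big1 ?addr0 ?signr_eq0 // => k ki.
  by rewrite (inj_eq einj) (negPf ki).
move=> x; under eq_bigr do rewrite ffunE.
rewrite exchange_big /=.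
(* Since the sign flips at each step, the contribution of [e i] at [x] is a difference of
   consecutive terms, and the sum telescopes around the cycle. *)
have inc i : \sum_(f in incident G x) (if e i == f then sg i else 0) =
    (if x == v i then sg i else 0) -
    (if x == v (ordS i) then sg (ordS i) else 0).
  have -> : sg (ordS i) = - sg i.
    by rewrite /sg vA; case: (_ \in A); rewrite ?expr0 ?expr1 ?opprK.
  rewrite -big_mkcondr /=.
  have [xe|xe] := boolP (x \in ends G (e i)).
    rewrite (big_pred1 (e i)); last first.
      move=> f /=; rewrite inE [RHS]eq_sym.
      by case: eqP => [<-|]; rewrite ?xe ?andbF.
    move: xe (vS i); rewrite ends_e => /set2P[] ->; rewrite eqxx.
      by move=> /negPf->; rewrite subr0.
    by rewrite eq_sym => /negPf->; rewrite sub0r opprK.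
  rewrite big_pred0; last first.
    by move=> f /=; rewrite inE; case: eqP => [<-|]; rewrite ?(negPf xe) ?andbF.
  move: xe; rewrite ends_e in_set2 negb_or => /andP[/negPf-> /negPf->].
  by rewrite subr0.
under eq_bigr do rewrite inc.
rewrite sumrB [X in _ - X](_ : _ = \sum_i (if x == v i then sg i else 0)).
  by rewrite subrr.
by rewrite [RHS](reindex_inj (@ordS_inj _)).
Qed.

End Balanced.

(** * Faces, vertices and one-dimensional sets *)

Section Faces.
Variables (R : realType) (E : finType).
Local Notation X := {ffun E -> R^o}.
Implicit Types (P F : set X) (x y z : X).

Lemma dotp_lin (c : X) (s t : R) x y :
  dotp c (s *: x + t *: y) = s * dotp c x + t * dotp c y.
Proof.
rewrite /dotp !mulr_sumr -big_split; apply: eq_bigr => e _.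
by rewrite !ffunE mulrDr; congr (_ + _); exact: mulrCA.
Qed.

(** A weighted mean, with positive weights, of two numbers at most [d] equals [d] only if both
    do. *)
Lemma face_segment P F y z (t : R) :
  is_face P F -> P y -> P z -> P ((1 - t) *: y + t *: z) -> 0 < t < 1 ->
  F ((1 - t) *: y + t *: z) <-> F y /\ F z.
Proof.
case=> c [d [cP ->]] Py Pz Pyz t01; have [cy cz] := (cP _ Py, cP _ Pz).
split=> [[_ /=]|[[_ /= yd] [_ /= zd]]]; last first.
  by split=> //=; rewrite dotp_lin yd zd; ring.
rewrite dotp_lin => yzd.
by split; split=> //=; nra.
Qed.

Lemma vertex_in P x : is_vertex P x -> P x.
Proof.
case=> c [d [_ xF]].
by have [] : (P `&` [set x | dotp c x = d])%classic x by rewrite -xF.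
Qed.

Lemma vertex_segment P x y z (t : R) :
  is_vertex P x -> P y -> P z -> 0 < t < 1 -> x = (1 - t) *: y + t *: z ->
  y = x /\ z = x.
Proof.
move=> xP Py Pz t01 xE; have Px := vertex_in xP.
have := @face_segment P [set x]%classic y z t xP Py Pz.
by rewrite -xE => /(_ Px t01)[+ _]; apply.
Qed.

Lemma affine_hull_segment F u w :
  F u -> F w -> (forall x, F x -> exists t : R, x - u = t *: (w - u)) ->
  affine_hull F = [set x | x - u \in <[w - u]>%VS]%classic.
Proof.
move=> Fu Fw line; apply/seteqP; split=> [x [n [p [a [Fp a1 ->]]]]|x /=].
  rewrite /=; have -> : \sum_(i < n) a i *: p i - u = \sum_(i < n) a i *: (p i - u).
    under [RHS]eq_bigr do rewrite scalerBr.
    by rewrite sumrB -scaler_suml a1 scale1r.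
  apply: memv_suml => i _; apply: memvZ.
  by have [t ->] := line _ (Fp i); apply: memvZ; apply: memv_line.
case/vlineP=> t xu; exists 2, (fun i => if i == 0 then u else w).
exists (fun i => if i == 0 then 1 - t else t).
split=> [i||]; first by case: ifP.
  by rewrite !big_ord_recl big_ord0 /=; ring.
rewrite !big_ord_recl big_ord0 /= addr0 -[LHS](subrK u) xu.
by rewrite scalerBr scalerBl scale1r addrC addrA addrAC.
Qed.

(** The direction space has dimension one and contains the nonzero vector [w - u], which therefore
    spans it. *)
Lemma dim1_line F u w x y :
  has_dim F 1 -> F u -> F w -> u <> w -> F x -> F y ->
  exists a : R, x - y = a *: (w - u).
Proof.
case=> x0 [U [dimU hullF]] Fu Fw uw Fx Fy.
have diffU p q : F p -> F q -> p - q \in U.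
  have hullU r : F r -> r - x0 \in U.
    move=> Fr; have : affine_hull F r.
      exists 1, (fun=> r), (fun=> 1); split=> //; first by rewrite big_ord1.
      by rewrite big_ord1 scale1r.
    by rewrite hullF.
  move=> Fp Fq; have -> : p - q = (p - x0) - (q - x0) by rewrite opprB subrKA.
  by rewrite memvB ?hullU.
have UE : (<[w - u]> = U)%VS.
  apply/eqP; rewrite eqEdim dimU dim_vline -memvE diffU //=.
  by rewrite subr_eq0; case: eqP => // wu; case: uw.
by apply/vlineP; rewrite UE diffU.
Qed.

Lemma perturbation_size x y :
  (forall e, 0 <= (x e : R)) -> (forall e, y e != 0 -> 0 < (x e : R)) ->
  exists2 r : R, 0 < r & forall e, r * `|y e : R| <= x e.
Proof.
move=> x0 xy; pose q e : R := `|y e : R| / x e.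
have q0 e : 0 <= q e by rewrite divr_ge0.
have S0 : 0 < 1 + \sum_e q e by rewrite ltr_wpDr // sumr_ge0.
(* The sum dominates each ratio [q e], and the added 1 keeps the denominator positive when all
   ratios vanish. *)
exists (1 + \sum_e q e)^-1; first by rewrite invr_gt0.
move=> e; have [ye|/xy xe] := eqVneq (y e) 0; first by rewrite ye normr0 mulr0.
rewrite mulrC ler_pdivrMr // mulrC -ler_pdivrMr // -/(q e).
by rewrite (bigD1 e) //= addrCA lerDl addr_ge0 // sumr_ge0.
Qed.

End Faces.

(** * Edges of the polytope as lines of balanced vectors *)

Section BMatchings.
Variables (R : realType) (V E : finType) (G : multigraph V E) (b : V -> R).
Local Notation X := {ffun E -> R^o}.
Local Notation P := (bmatching_polytope G b).
Implicit Types (F : set X) (x y z u w : X).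

Local Notation supp_on y u w :=
  ([set e | y e != 0] \subset (union_subgraph (gr V u) (gr V w)).2).

Lemma scale_reg (a c : R) : a *: (c : R^o) = a * c.
Proof. by []. Qed.

Lemma bmatching_segment x y (t : R) :
  P x -> P y -> 0 <= t <= 1 -> P ((1 - t) *: x + t *: y).
Proof.
move=> [x0 xb] [y0 yb] /andP[t0 t1]; split=> [e|v].
  by rewrite !ffunE addr_ge0 // mulr_ge0 // subr_ge0.
rewrite (eq_bigr (fun e => (1 - t) * (x e : R) + t * (y e : R))).
  by rewrite big_split /= -!mulr_sumr xb yb; ring.
by move=> e _; rewrite !ffunE.
Qed.

Lemma balancedB x y : P x -> P y -> balanced G (x - y).
Proof.
move=> [_ xb] [_ yb] v; rewrite (eq_bigr (fun e => (x e : R) - (y e : R))).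
  by rewrite sumrB xb yb subrr.
by move=> e _; rewrite !ffunE.
Qed.

Lemma bmatching_shift x y (r : R) :
  P x -> balanced G y -> (forall e, `|r * (y e : R)| <= x e) ->
  P (x + r *: y).
Proof.
move=> [x0 xb] by0 yx; split=> [e|v].
  rewrite !ffunE; have := yx e; rewrite ler_norml => /andP[yxe _].
  by rewrite scale_reg -lerBlDl sub0r.
rewrite (eq_bigr (fun e => (x e : R) + r * (y e : R))).
  by rewrite big_split /= -mulr_sumr by0 mulr0 addr0 xb.
by move=> e _; rewrite !ffunE.
Qed.

Lemma edge_balanced F u w y :
  is_edge P F -> F u -> F w -> u <> w -> balanced G y -> supp_on y u w ->
  exists a : R, y = a *: (w - u).
Proof.
move=> [Fface dimF] Fu Fw uw by0 /fintype.subsetP yuw.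
have FP x : F x -> P x by case: Fface => c [d [_ ->]] [].
have half : 0 < (2^-1 : R) < 1 by apply/andP; split; lra.
have half1 : 1 - 2^-1 = 2^-1 :> R by field.
(* The midpoint is positive on the whole union of the supports, so it can be moved by a small
   multiple of [y] in both directions. *)
pose m : X := (1 - 2^-1) *: u + 2^-1 *: w.
have Pm : P m by apply: bmatching_segment; [exact: FP|exact: FP|lra].
have Fm : F m by apply/(face_segment Fface (FP _ Fu) (FP _ Fw) Pm half).
have mE e : (m e : R) = ((u e : R) + (w e : R)) / 2.
  by rewrite !ffunE half1 -mulrDr mulrC.
have u0 e : 0 <= (u e : R) by case: (FP _ Fu).
have w0 e : 0 <= (w e : R) by case: (FP _ Fw).
have [|e ye|r r0 ry] := @perturbation_size R E m y; first by case: Pm.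
  have := yuw e; rewrite !inE ye mE => /(_ isT) /orP[] ?;
    have := u0 e; have := w0 e; lra.
have Pp : P (m + r *: y).
  by apply: bmatching_shift => // e; rewrite normrM (gtr0_norm r0).
have Pn : P (m + (- r) *: y).
  by apply: bmatching_shift => [||e] //; rewrite normrM normrN (gtr0_norm r0).
have mid : (1 - 2^-1) *: (m + r *: y) + 2^-1 *: (m + (- r) *: y) = m.
  rewrite half1 -scalerDr scaleNr addrACA subrr addr0 -mulr2n -scaler_nat.
  by rewrite scalerA mulVf ?scale1r ?pnatr_eq0.
have [Fp _] : F (m + r *: y) /\ F (m + (- r) *: y).
  by apply/(face_segment Fface Pp Pn _ half); rewrite mid.
have [a ya] := dim1_line dimF Fu Fw uw Fp Fm.
exists (r^-1 * a); rewrite -scalerA -ya addrC addKr scalerA mulVf ?scale1r //.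
by rewrite gt_eqF.
Qed.

Lemma line_edge u w :
  is_vertex P u -> is_vertex P w -> u <> w ->
  (forall y, balanced G y -> supp_on y u w -> exists a : R, y = a *: (w - u)) ->
  vertices_of_an_edge P u w.
Proof.
move=> Vu Vw uw line.
have [Pu Pw] := (vertex_in Vu, vertex_in Vw).
have [[u0 _] [w0 _]] := (Pu, Pw).
pose S := (union_subgraph (gr V u) (gr V w)).2.
(* On the polytope this functional is at most 0, with equality exactly at the points supported in
   [S]. *)
pose c : X := [ffun e => if e \in S then 0 else -1].
pose F : set X := (P `&` [set x | dotp c x = 0])%classic.
have cx x e : P x -> (c e : R) * (x e : R) <= 0.
  by case=> x0 _; rewrite ffunE; case: ifP; rewrite ?mul0r // mulN1r oppr_le0.
have Fface : is_face P F.
  by exists c, 0; split=> // x Px; apply: sumr_le0 => e _; apply: cx.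
have FP x : F x -> P x by case.
have FS x : P x -> F x <-> forall e, e \notin S -> x e = 0.
  move=> Px; split=> [[_ /= x0] e eS|xS].
    have := x0; rewrite /dotp (bigD1 e) //= ffunE (negPf eS) mulN1r.
    move/eqP; rewrite addrC subr_eq add0r => /eqP xe.
    apply/eqP; rewrite eq_le -{1}xe; case: Px (Px) => [-> _] Px; rewrite andbT.
    by apply: sumr_le0 => f _; apply: cx.
  split=> //=; apply: big1 => e _; rewrite ffunE.
  by case: ifPn => [|/xS ->]; rewrite ?mul0r ?mulr0.
have zero_out x e : (forall e, 0 <= (x e : R)) -> ~~ (0 < (x e : R)) -> x e = 0.
  by move=> x0; rewrite -leNgt => xe; apply/eqP; rewrite eq_le xe x0.
have Fu : F u.
  apply/FS => // e; rewrite !inE negb_or => /andP[ue _]; exact: zero_out.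
have Fw : F w.
  apply/FS => // e; rewrite !inE negb_or => /andP[_ we]; exact: zero_out.
have Fline x : F x -> exists t : R, x - u = t *: (w - u).
  move=> Fx; apply: line; first by apply: balancedB; [exact: FP|].
  apply/fintype.subsetP => e; rewrite inE; apply: contraNT => eS.
  by rewrite !ffunE !(iffLR (FS _ _) _ _ eS) ?subrr //; exact: FP.
exists F; split; first split=> //.
  exists u, <[w - u]>%VS; split; last exact: affine_hull_segment.
  by rewrite dim_vline subr_eq0; case: eqP => // wu; case: uw.
have Fvert x : is_vertex P x -> F x -> is_vertex F x.
  move=> [c' [d [cP xF]]] Fx; exists c', d; split=> [y /FP|]; first exact: cP.
  apply/seteqP; split=> [y ->|y [/FP Py yd]]; last by rewrite xF.
  have /= [Px xd] : (P `&` [set x | dotp c' x = d])%classic x by rewrite -xF.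
  by split.
apply/seteqP; split=> [x /= Vx|x [->|->]]; try exact: Fvert.
have Fx := vertex_in Vx.
have [t /eqP] := Fline x Fx; rewrite subr_eq => /eqP xt.
(* On the line through [u] and [w], one of [u], [x], [w] lies between the other two according to
   [t]. A vertex is never strictly between two distinct points, so [x] is [u] or [w]. *)
have [t0|t0|t0] := ltgtP t 0; last by left; rewrite xt t0 scale0r add0r.
  (* The parameter comes from solving [x = (1 - t) u + t w] for [u]; likewise [t^-1] below comes
     from solving for [w]. *)
  left; have [] // := @vertex_segment R E P u x w (t / (t - 1)) Vu (FP _ Fx) Pw.
    by rewrite ltr_ndivlMr ?ltr_ndivrMr; lra.
  have t1 : t - 1 != 0 by rewrite subr_eq0 lt_eqF // (lt_trans t0).
  by apply/ffunP => e; rewrite xt !ffunE !scale_reg; field.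
have [t1|t1|t1] := ltgtP t 1; last by right; rewrite xt t1 scale1r subrK.
  have [] // := @vertex_segment R E F x u w t Vx Fu Fw; first by rewrite t0.
    by rewrite xt; apply/ffunP => e; rewrite !ffunE !scale_reg; ring.
  by move=> ux; left.
right; have [] // := @vertex_segment R E P w u x t^-1 Vw Pu (FP _ Fx).
  by rewrite invr_gt0 t0 invf_lt1.
by apply/ffunP => e; rewrite xt !ffunE !scale_reg; field; rewrite gt_eqF.
Qed.

End BMatchings.

(** * Cycles are determined by their edge sets *)

Section CycleSubgraphs.
Variables (V E : finType) (G : multigraph V E).

Lemma cycle_edges_neq0 (C : subgraph V E) : is_cycle G C -> C.2 != set0.
Proof.
case=> n [v [e [_ _ _ _ ->]]]; apply/set0Pn; exists (e ord0).
exact: imset_f.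
Qed.

Lemma cycle_vertices (C : subgraph V E) :
  is_cycle G C -> C.1 = \bigcup_(e in C.2) ends G e.
Proof.
case=> n [v [e [_ _ ends_e -> ->]]]; apply/setP => x.
apply/imsetP/bigcupP => [[i _ ->]|[_ /imsetP[i _ ->]]].
  by exists (e i); [exact: imset_f|rewrite ends_e set21].
by rewrite ends_e => /set2P[] ->; [exists i|exists (ordS i)].
Qed.

Lemma cycle_eq (C D : subgraph V E) :
  is_cycle G C -> is_cycle G D -> C.2 = D.2 -> C = D.
Proof.
move=> /cycle_vertices C1 /cycle_vertices D1 CD.
by rewrite [C]surjective_pairing [D]surjective_pairing C1 D1 CD.
Qed.

End CycleSubgraphs.

(** * Adjacency of vertices and uniqueness of the cycle *)

Theorem corollary26 (R : realType) (V E : finType) (G : multigraph V E)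
    (b : V -> R) (u w : {ffun E -> R^o}) :
  (0 < #|V|)%N ->
  bipartite G ->
  (forall v : V, 0 <= b v) ->
  is_vertex (bmatching_polytope G b) u ->
  is_vertex (bmatching_polytope G b) w ->
  u <> w ->
  vertices_of_an_edge (bmatching_polytope G b) u w <->
  exists! C : subgraph V E,
    is_cycle G C /\ contained C (union_subgraph (gr V u) (gr V w)).
Proof.
move=> _ bipG _ Vu Vw uw.
have [Pu Pw] := (vertex_in Vu, vertex_in Vw).
set H := union_subgraph _ _.
have d_bal : balanced G (w - u) by exact: balancedB Pw Pu.
have d_neq0 : w - u != 0 by rewrite subr_eq0; case: eqP => // wu; case: uw.
have d_supp : [set e | (w - u) e != 0] \subset H.2.
  apply/fintype.subsetP => e; rewrite !inE !ffunE; apply: contraNT.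
  rewrite negb_or -!leNgt => /andP[ue we].
  have [[u0 _] [w0 _]] := (Pu, Pw).
  have -> : u e = 0 by apply/eqP; rewrite eq_le ue u0.
  have -> : w e = 0 by apply/eqP; rewrite eq_le we w0.
  by rewrite subrr.
have containedP (C : subgraph V E) : C.2 \subset H.2 -> contained C H.
  by move=> CH; split=> //; rewrite /= finset.setUid subsetT.
split=> [[F [Fedge FV]]|[C [[Ccyc [_ CH]] Cuniq]]].
  have FuwP x : x = u \/ x = w -> F x.
    move=> xuw; apply: (@vertex_in R E F).
    by rewrite -/([set x | is_vertex F x]%classic x) FV.
  have [Fu Fw] := (FuwP u (or_introl erefl), FuwP w (or_intror erefl)).
  have line := edge_balanced Fedge Fu Fw uw.
  (* The alternating vector of [C] is a multiple of [w - u], and a nonzero one because a cycle has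
     an edge; hence the supports agree. *)
  have supp (C : subgraph V E) : is_cycle G C -> C.2 \subset H.2 ->
      C.2 = [set e | (w - u) e != 0].
    move=> Ccyc; have [y [ybal yC]] := cycle_balanced R bipG Ccyc.
    rewrite -yC => /(line _ ybal)[a ya].
    have a0 : a != 0.
      apply: contra_neq (cycle_edges_neq0 Ccyc) => a0.
      by apply/setP => e; rewrite -yC ya a0 scale0r !inE ffunE eqxx.
    by apply/setP => e; rewrite !inE ya [X in X != 0]ffunE scaler_eq0 negb_or a0.
  have [C [Ccyc Cd]] := balanced_cycle d_bal d_neq0.
  have CH := fintype.subset_trans Cd d_supp.
  exists C; split=> [|D [Dcyc [_ DH]]]; first by split=> //; exact: containedP.
  apply: (cycle_eq Ccyc Dcyc).
  exact: etrans (supp C Ccyc CH) (esym (supp D Dcyc DH)).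
apply: line_edge => // y ybal ysupp.
have [e0 e0C] := set0Pn _ (cycle_edges_neq0 Ccyc).
(* Otherwise the support of [z] contains a cycle, which must be [C] and so uses [e0]. *)
have vanish z : balanced G z -> [set e | z e != 0] \subset H.2 -> z e0 = 0 ->
    z = 0.
  move=> zbal zH z0; apply/eqP; apply: contraTT isT => /(balanced_cycle zbal).
  case=> D [Dcyc Dz]; have CD : C = D.
    by apply: Cuniq; split=> //; apply/containedP/(fintype.subset_trans Dz).
  by have := fintype.subsetP Dz e0; rewrite -CD e0C inE z0 eqxx => /(_ isT).
have d0 : (w - u) e0 != 0 by apply: contra_neq d_neq0; exact: vanish.
(* This coefficient makes the difference of [y] and the multiple of [w - u] zero at [e0], so that
   [vanish] applies to it. *)
exists (y e0 / (w - u) e0 : R); apply/eqP; rewrite -subr_eq0; apply/eqP.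
apply: vanish.
- by rewrite -[y]scale1r -scaleNr; exact: balanced_lin.
- apply/fintype.subsetP => e; rewrite inE; apply: contraNT => eH.
  have ye : y e = 0.
    apply/eqP; apply: contraNT eH => ye.
    by apply: (fintype.subsetP ysupp); rewrite inE.
  have de : (w - u) e = 0.
    apply/eqP; apply: contraNT eH => de.
    by apply: (fintype.subsetP d_supp); rewrite inE.
  by rewrite !ffunE in de *; rewrite ye de scaler0 subr0.
- rewrite [LHS]ffunE [X in _ + X]ffunE [X in _ - X]ffunE scale_reg.
  by rewrite divfK ?subrr.
Qed.
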